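(* Let $p_1,p_2,q$ be real numbers with $1\le p_1<p_2\le q<\infty$. Then $w\ell^{p_2}_q\subseteq\ell^{p_1}_q$, and this inclusion is proper, i.e. $\ell^{p_1}_q\setminus w\ell^{p_2}_q\neq\emptyset$.
   Context: For $m\in\mathbb{Z}$ and $N\in\mathbb{N}_0=\mathbb{N}\cup\{0\}$ let $S_{m,N}:=\{m-N,\ldots,m,\ldots,m+N\}\subset\mathbb{Z}$, so $|S_{m,N}|=2N+1$. For $1\le p\le q<\infty$, the discrete Morrey space $\ell^p_q=\ell^p_q(\mathbb{Z})$ is the set of all scalar sequences $x=(x_j)_{j\in\mathbb{Z}}$ such that $$\|x\|_{\ell^p_q}:=\sup_{m\in\mathbb{Z},\,N\in\mathbb{N}_0}|S_{m,N}|^{\frac1q-\frac1p}\Big(\sum_{j\in S_{m,N}}|x_j|^p\Big)^{\frac1p}<\infty.$$ The weak type discrete Morrey space $w\ell^p_q$ is the set of all scalar sequences $x=(x_j)_{j\in\mathbb{Z}}$ for which the quasi-norm $$\|x\|_{w\ell^p_q}:=\sup_{m\in\mathbb{Z},\,N\in\mathbb{N}_0,\,\gamma>0}\gamma\,|S_{m,N}|^{\frac1q-\frac1p}\,\big|\{j\in S_{m,N}:|x_j|>\gamma\}\big|^{\frac1p}$$ is finite, where $|A|$ denotes the cardinality of a finite set $A$. *)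

(* Defs.v *)
From HB Require Import structures.
From mathcomp Require Import all_boot all_order all_algebra finmap zify.
From mathcomp Require Import all_classical all_reals all_analysis.

Set Implicit Arguments.
Unset Strict Implicit.
Unset Printing Implicit Defensive.

Import Order.TTheory GRing.Theory Num.Theory.
Local Open Scope fset_scope.
Local Open Scope classical_set_scope.
Local Open Scope ring_scope.

Definition window (m : int) (N : nat) : {fset int} :=
  [fset m - N%:Z + i%:Z | i in iota 0 N.*2.+1].

Lemma in_window m N j :
  (j \in window m N) = (m - N%:Z <= j <= m + N%:Z).
Proof.
apply/imfsetP/idP => [[i]|mNj].
  rewrite mem_iota => iN ->; lia.
exists (absz (j - m + N%:Z)); last by lia.
by rewrite [_ \in _]mem_iota; lia.
Qed.

Lemma card_window m N : #|` window m N| = N.*2.+1.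
Proof.
rewrite card_imfset => [|i j]; last by lia.
rewrite -[RHS](size_iota 0); apply/perm_size/uniq_perm.
- exact: enum_finmem_uniq.
- exact: iota_uniq.
- by move=> i; rewrite enum_finmemE.
Qed.

(* The norm `|_| of a normedZmodType R takes its values in R, so V can be R
   itself or Rcomplex R, the complex numbers R[i] with their R-valued
   modulus. *)
Section DiscreteMorrey.
Context (R : realType) (V : normedZmodType R).
Implicit Types (p q : R) (x : int -> V).

Definition morrey_norm p q x : \bar R :=
  ereal_sup [set z | exists (m : int) (N : nat),
    z = (#|` window m N|%:R `^ (q^-1 - p^-1)
         * (\sum_(j <- window m N) `|x j| `^ p) `^ p^-1)%:E].

Definition morrey p q : set (int -> V) :=
  [set x | (morrey_norm p q x < +oo)%E].

Definition weak_morrey_norm p q x : \bar R :=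
  ereal_sup [set z | exists (m : int) (N : nat) (g : R), 0 < g /\
    z = (g * #|` window m N|%:R `^ (q^-1 - p^-1)
         * #|` [fset j in window m N | g < `|x j|] |%:R `^ p^-1)%:E].

Definition weak_morrey p q : set (int -> V) :=
  [set x | (weak_morrey_norm p q x < +oo)%E].

End DiscreteMorrey.

Arguments morrey_norm R V p q x : clear implicits.
Arguments morrey R V p q : clear implicits.
Arguments weak_morrey_norm R V p q x : clear implicits.
Arguments weak_morrey R V p q : clear implicits.

(* Main.v *)
Require Import Defs.
From mathcomp Require Import all_boot all_order all_algebra finmap zify ring lra.
From mathcomp Require Import all_classical all_reals all_analysis complex.

Import Order.TTheory GRing.Theory Num.Theory.
Local Open Scope classical_set_scope.
Local Open Scope ring_scope.

(** Inclusion: on a window with n elements, cut |x| at the height n^(-1/q).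
    The small values contribute at most n * n^(-p1/q) = n^(1 - p1/q); the
    values in the dyadic layer of height 2^k n^(-1/q) are counted by the weak
    norm, and their contributions to the sum of the |x_j|^p1 decay like
    2^(-k (p2 - p1)).

    Strictness: with s = 1 - p1/q, let x be the indicator function of the set
    of integers at which j |-> floor (max(j, 0)^s) jumps.  As t |-> t^s is
    subadditive, every window with n elements contains at most n^s + 1 jumps,
    so x lies in the Morrey space; the windows [0, 2N] contain about n^s of
    them, and n^s is not O(n^(1 - p2/q)). *)

(** * Suprema, real powers and sums over windows *)

Lemma ereal_sup_ltyP (R : realType) (S : set (\bar R)) :
  (ereal_sup S < +oo)%E <->
  exists2 K : R, 0 <= K & forall z, S z -> (z <= K%:E)%E.
Proof.
split=> [Soo|[K _ SK]]; last first.
  by apply: (@le_lt_trans _ _ K%:E); [exact: ge_ereal_sup | exact: ltry].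
exists (Num.max 0 (fine (ereal_sup S))) => [|z Sz]; first by rewrite le_max lexx.
have zS : (z <= ereal_sup S)%E by exact: ereal_sup_ubound.
apply: (le_trans zS); move: Soo {zS}; case: (ereal_sup S) => [r _||] //=.
- by rewrite lee_fin le_max lexx orbT.
- by rewrite leNye.
Qed.

Lemma ler_powR2r (R : realType) (p x y : R) : 0 < p -> 0 <= x -> 0 <= y ->
  (x `^ p <= y `^ p) = (x <= y).
Proof.
move=> p0 x0 y0; apply/idP/idP; last first.
  by apply: ge0_ler_powR; rewrite ?nnegrE // ltW.
by apply: contraTT; rewrite -!ltNge; apply: gt0_ltr_powR; rewrite ?nnegrE.
Qed.

(** With c = a + b > 0, a ratio u/c in (0, 1] satisfies u/c <= (u/c)^s because s <= 1, so (u/c) c^s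
    <= u^s. Adding the cases u = a and u = b leaves c^s on the left. *)
Lemma powR_subadditive {R : realType} {s a b : R} :
  s <= 1 -> 0 <= a -> 0 <= b -> (a + b) `^ s <= a `^ s + b `^ s.
Proof.
move=> s1 a0 b0; have [c0|c0] := eqVneq (a + b) 0.
  have /eqP -> : a == 0 by lra.
  by rewrite add0r lerDr powR_ge0.
have {}c0 : 0 < a + b by rewrite lt_def c0 addr_ge0.
have frac u : 0 <= u -> u <= a + b -> u / (a + b) * (a + b) `^ s <= u `^ s.
  rewrite le_eqVlt => /predU1P[<- _|u0 uc]; first by rewrite !mul0r powR_ge0.
  have v0 : 0 < u / (a + b) by exact: divr_gt0.
  have -> : u `^ s = (u / (a + b)) `^ s * (a + b) `^ s.
    by rewrite -powRM ?(ltW v0) ?(ltW c0)// divfK ?gt_eqF.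
  apply: ler_wpM2r; first exact: powR_ge0.
  by apply: ger1_powR; rewrite // v0/= ler_pdivrMr// mul1r.
have := lerD (frac a a0 _) (frac b b0 _).
rewrite -mulrDl -mulrDl divff ?gt_eqF// mul1r.
by apply; [rewrite lerDl | rewrite lerDr].
Qed.

Lemma card_fset_sum_bool (R : realType) (T : choiceType) (A : {fset T})
  (P : pred T) :
  #|` [fset j in A | P j]%fset|%:R = \sum_(j <- A) (P j)%:R :> R.
Proof.
rewrite card_fset_sum1 -big_fset_condE natr_sum big_mkcond /=.
by apply: eq_bigr => j _; case: (P j).
Qed.

Lemma sum_window (R : realType) (F : int -> R) m N :
  \sum_(j <- window m N) (F (j + 1) - F j) = F (m + N%:Z + 1) - F (m - N%:Z).
Proof.
rewrite big_imfset; last by move=> i j _ _; lia.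
rewrite (perm_big (iota 0 N.*2.+1)); last first.
  apply: uniq_perm (enum_finmem_uniq _) (iota_uniq _ _) _ => i.
  by rewrite enum_finmemE.
transitivity (\sum_(0 <= i < N.*2.+1)
    (F (m - N%:Z + i.+1%:Z) - F (m - N%:Z + i%:Z))).
  rewrite /index_iota subn0; apply: eq_bigr => i _; congr (F _ - _); lia.
rewrite telescope_sumr //; congr (F _ - F _); lia.
Qed.

(** * Norm bounds as growth conditions, and dyadic layers *)

Section MorreyBounds.
Context {R : realType}.
Implicit Types p q : R.

(** Raise both sides to the power p and move the power of n to the right. The strong norm is the
    case g = 1; in the weak norm g is the level and T the count. *)
Lemma morrey_term_le {p q n g T K : R} :
  0 < p -> 0 < n -> 0 <= g -> 0 <= T -> 0 <= K ->
  (g * n `^ (q^-1 - p^-1) * T `^ p^-1 <= K) =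
  (g `^ p * T <= K `^ p * n `^ (1 - p / q)).
Proof.
move=> p0 n0 g0 T0 K0.
have p1 : p^-1 * p = 1 by rewrite mulVf ?gt_eqF.
rewrite -(@ler_powR2r _ p) ?mulr_ge0 ?powR_ge0//.
rewrite !powRM ?mulr_ge0 ?powR_ge0// -!powRrM p1 (powRr1 T0).
have -> : (q^-1 - p^-1) * p = - (1 - p / q) by rewrite mulrBl p1 mulrC opprB.
by rewrite powRN mulrAC ler_pdivrMr ?powR_gt0.
Qed.

Lemma morreyP (V : normedZmodType R) {p q} {x : int -> V} : 0 < p ->
  morrey R V p q x <-> exists2 C : R, 0 <= C & forall m N,
    \sum_(j <- window m N) `|x j| `^ p <= C * N.*2.+1%:R `^ (1 - p / q).
Proof.
move=> p0; have sum0 m N : 0 <= \sum_(j <- window m N) `|x j| `^ p.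
  by apply: sumr_ge0 => j _; exact: powR_ge0.
have p1 : p^-1 * p = 1 by rewrite mulVf ?gt_eqF.
have termE K m N : 0 <= K ->
    (#|` window m N|%:R `^ (q^-1 - p^-1) *
       (\sum_(j <- window m N) `|x j| `^ p) `^ p^-1 <= K) =
    (\sum_(j <- window m N) `|x j| `^ p <= K `^ p * N.*2.+1%:R `^ (1 - p / q)).
  move=> K0; rewrite card_window.
  by have := @morrey_term_le p q N.*2.+1%:R 1 _ K p0 (ltr0Sn _ _) ler01
    (sum0 m N) K0; rewrite powR1 !mul1r.
rewrite /morrey /morrey_norm /=; split=> [/ereal_sup_ltyP[K K0 le_K]|[C C0 le_C]].
  exists (K `^ p) => [|m N]; first exact: powR_ge0.
  by rewrite -termE// -lee_fin; apply: le_K; exists m, N.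
apply/ereal_sup_ltyP; exists (C `^ p^-1) => [|_ [m [N ->]]]; first exact: powR_ge0.
by rewrite lee_fin termE ?powR_ge0// -powRrM p1 powRr1.
Qed.

Lemma weak_morreyP (V : normedZmodType R) {p q} {x : int -> V} : 0 < p ->
  weak_morrey R V p q x <-> exists2 C : R, 0 <= C & forall m N g, 0 < g ->
    g `^ p * (\sum_(j <- window m N) (g < `|x j|)%R%:R)
      <= C * N.*2.+1%:R `^ (1 - p / q).
Proof.
move=> p0; have p1 : p^-1 * p = 1 by rewrite mulVf ?gt_eqF.
have termE K m N g : 0 <= K -> 0 < g ->
    (g * #|` window m N|%:R `^ (q^-1 - p^-1) *
       #|` [fset j in window m N | g < `|x j|]%fset|%:R `^ p^-1 <= K) =
    (g `^ p * (\sum_(j <- window m N) (g < `|x j|)%R%:R)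
       <= K `^ p * N.*2.+1%:R `^ (1 - p / q)).
  move=> K0 g0; rewrite card_window (morrey_term_le p0 (ltr0Sn _ _) (ltW g0))//.
  by rewrite card_fset_sum_bool.
rewrite /weak_morrey /weak_morrey_norm /=.
split=> [/ereal_sup_ltyP[K K0 le_K]|[C C0 le_C]].
  exists (K `^ p) => [|m N g g0]; first exact: powR_ge0.
  by rewrite -termE// -lee_fin; apply: le_K; exists m, N, g.
apply/ereal_sup_ltyP; exists (C `^ p^-1) => [|_ [m [N [g [g0 ->]]]]].
  exact: powR_ge0.
by rewrite lee_fin termE ?powR_ge0// -powRrM p1 powRr1 ?le_C.
Qed.

(** Induction on M: if t > 2^M, the top layer alone dominates t^p; otherwise it vanishes and the
    bound for M applies. The summand 1 takes care of t <= 1. *)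
Lemma powR_le_dyadic p (t : R) M : 0 <= p -> 0 <= t <= 2 ^+ M ->
  t `^ p <= 1 + \sum_(k < M) (2 ^+ k.+1) `^ p * (2 ^+ k < t)%R%:R.
Proof.
move=> p0; elim: M => [|M IH] /andP[t0 tM].
  by have := ge0_ler_powR p0 _ _ tM; rewrite big_ord0 addr0 expr0 powR1 !nnegrE; exact.
rewrite big_ord_recr /=; case: ltP => [tgt|tle].
  apply: (@le_trans _ _ ((2 ^+ M.+1) `^ p)).
    by apply: ge0_ler_powR; rewrite ?nnegrE ?exprn_ge0.
  rewrite mulr1 addrA lerDr addr_ge0// sumr_ge0//.
by rewrite mulr0 addr0 IH// t0.
Qed.

Lemma geometric_sum_le (r : R) M : 0 <= r < 1 ->
  \sum_(k < M) r ^+ k <= (1 - r)^-1.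
Proof.
move=> /andP[r0 r1]; rewrite -[leRHS]mul1r ler_pdivlMr ?subr_gt0// mulrC.
by rewrite -opprB mulNr -subrX1 opprB gerBl exprn_ge0.
Qed.

End MorreyBounds.

(** * The inclusion, by dyadic layers *)

Section Inclusion.
Context {R : realType} (V : normedZmodType R).

Lemma weak_morrey_sub_morrey (p1 p2 q : R) : 0 < p1 -> p1 < p2 ->
  weak_morrey R V p2 q `<=` morrey R V p1 q.
Proof.
move=> p10 p12 x; have p20 : 0 < p2 by exact: lt_trans p12.
move=> /(weak_morreyP V p20)[C C0 le_C]; apply/(morreyP V p10).
pose r : R := 2 `^ (p1 - p2).
have r01 : 0 <= r < 1.
  rewrite powR_ge0 /r -opprB powRN invf_lt1 ?powR_gt0//=.
  have /gt0_ltr_powR/(_ 1 2) : 0 < p2 - p1 by rewrite subr_gt0.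
  by rewrite powR1 !nnegrE ltr1n; exact.
(* The 1 pays for the small values; layer k costs at most C 2^p1 r^k per element of the window, and
   these costs form a geometric series. *)
exists (1 + C * 2 `^ p1 * (1 - r)^-1) => [|m N].
  have /andP[_ r1] := r01.
  by rewrite addr_ge0// !mulr_ge0 ?powR_ge0// invr_ge0 subr_ge0 ltW.
set n : R := N.*2.+1%:R; have n0 : 0 < n by exact: ltr0Sn.
pose a : R := n `^ (- q^-1); have a0 : 0 < a by exact: powR_gt0.
(* Used for p1, where it is the growth allowed in the goal, and for p2, where it is the growth in
   the weak bound. *)
have naE p : n * a `^ p = n `^ (1 - p / q).
  rewrite /a -powRrM -{1}(powRr1 (ltW n0)) -powRD ?(gt_eqF n0) ?implybT//.
  by rewrite mulNr (mulrC q^-1).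
pose t j := `|x j| / a.
have t0 j : 0 <= t j by rewrite divr_ge0// ltW.
(* Finitely many layers suffice, since each [t j] is at most the sum over the window. *)
have [M tM] : exists M, forall j, j \in window m N -> t j <= 2 ^+ M.
  pose s := \sum_(j <- window m N) t j.
  have s0 : 0 <= s by exact: sumr_ge0.
  exists (Num.truncn s).+1 => j jW; apply: (@le_trans _ _ s).
    by rewrite /s (big_rem j)//= lerDl sumr_ge0.
  apply: le_trans (ltW (truncnS_gt s)) _.
  by rewrite -natrX ler_nat ltnW// ltn_expl.
have xE j : `|x j| `^ p1 = a `^ p1 * t j `^ p1.
  by rewrite -powRM ?(ltW a0)// mulrC divfK ?gt_eqF.
rewrite (eq_bigr _ (fun j _ => xE j)) -mulr_sumr -naE (mulrC n) mulrCA.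
rewrite ler_pM2l ?powR_gt0//.
apply: (@le_trans _ _ (\sum_(j <- window m N)
    (1 + \sum_(k < M) (2 ^+ k.+1) `^ p1 * (2 ^+ k < t j)%R%:R))).
  rewrite [leLHS]big_seq [leRHS]big_seq; apply: ler_sum => j jW.
  by apply: powR_le_dyadic; [exact: ltW|rewrite t0 tM].
rewrite big_split /= mulrDl mul1r; apply: lerD.
  by rewrite big_const_seq count_predT card_window iter_addr_0.
rewrite exchange_big /=.
apply: (@le_trans _ _ (\sum_(k < M) (C * 2 `^ p1 * n) * r ^+ k)); last first.
  rewrite -mulr_sumr -mulrA -[leRHS]mulrA [_^-1 * _]mulrC !mulrA.
  apply: ler_wpM2l; last exact: geometric_sum_le.
  by rewrite !mulr_ge0 ?powR_ge0// ltW.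
apply: ler_sum => k _; rewrite -mulr_sumr.
have ga0 : 0 < 2 ^+ k * a by rewrite mulr_gt0 ?exprn_gt0.
(* At level 2^k a the weak bound counts the j with [t j] > 2^k; cancelling a^p2 leaves 2^(k p2) T <=
   C n. *)
have := le_C m N _ ga0; rewrite -/n.
under eq_bigr do rewrite -ltr_pdivlMr//.
set T := \sum_(j <- _) _; rewrite powRM ?exprn_ge0 ?(ltW a0)//.
rewrite -naE => leT.
have {}leT : (2 ^+ k) `^ p2 * T <= C * n.
  by rewrite -(@ler_pM2r _ (a `^ p2)) ?powR_gt0// mulrAC -[leRHS]mulrA.
have twok p : (2 ^+ k) `^ p = (2 `^ p) ^+ k :> R.
  by rewrite -(powR_mulrn k (ler0n R 2)) powRAC powR_mulrn ?powR_ge0.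
have -> : r ^+ k = (2 ^+ k) `^ p1 / (2 ^+ k) `^ p2.
  by rewrite !twok -expr_div_n -powRB// pnatr_eq0 implybT.
rewrite exprS powRM ?exprn_ge0// -mulrA [leRHS]mulrA ler_pdivlMr ?powR_gt0//.
rewrite [leLHS](_ : _ = 2 `^ p1 * (2 ^+ k) `^ p1 * ((2 ^+ k) `^ p2 * T));
  last by ring.
rewrite [leRHS](_ : _ = 2 `^ p1 * (2 ^+ k) `^ p1 * (C * n)); last by ring.
by rewrite ler_wpM2l ?mulr_ge0 ?powR_ge0.
Qed.

End Inclusion.

(** * Strictness, by the jumps of the floor of a power *)

Section Separation.
Context {R : realType} (s : R).
Hypotheses (s0 : 0 < s) (s1 : s <= 1).

(** Clamping at 0 makes the function constant on the nonpositive integers, so no jump occurs between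
    them. *)
Definition powR_floor (j : int) : nat :=
  Num.truncn ((absz (Num.max 0 j))%:R `^ s : R).

Lemma powR_floor_le j : (powR_floor j)%:R <= (absz (Num.max 0 j))%:R `^ s :> R.
Proof. by rewrite truncn_le powR_ge0. Qed.

Lemma powR_floor_gt j :
  (absz (Num.max 0 j))%:R `^ s < (powR_floor j).+1%:R :> R.
Proof. exact: truncnS_gt. Qed.

(** Subadditivity bounds the growth of the power by n^s, and taking the floor at j loses less than
    1. *)
Lemma powR_floor_increment j (n : nat) :
  (powR_floor (j + n%:Z))%:R < (powR_floor j).+1%:R + n%:R `^ s :> R.
Proof.
apply: le_lt_trans (powR_floor_le _) _.
apply: (@le_lt_trans _ _ (((absz (Num.max 0 j))%:R + n%:R) `^ s)).
  apply: ge0_ler_powR; rewrite ?nnegrE ?(ltW s0) ?addr_ge0//.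
  by rewrite -natrD ler_nat; lia.
apply: le_lt_trans (powR_subadditive s1 _ _) _ => //.
by rewrite ltrD2r powR_floor_gt.
Qed.

(** Jumps have height one, so the indicator of a jump equals the increment and its sums over windows
    telescope. *)
Lemma powR_floor_step j :
  (powR_floor j <= powR_floor (j + 1) <= (powR_floor j).+1)%N.
Proof.
apply/andP; split.
  apply: le_truncn; apply: ge0_ler_powR; rewrite ?nnegrE ?(ltW s0)//.
  by rewrite ler_nat; lia.
have := powR_floor_increment j 1; rewrite powR1 -natr1 => h.
by rewrite -ltnS -(ltr_nat R) -[X in _ < X]natr1 -natr1.
Qed.

End Separation.

(** Keeping the value [e] abstract lets one sequence serve real and complex scalars; [e] will have
    norm 1. *)
Definition jump_seq (R : realType) (V : zmodType) (s : R) (e : V) (j : int) :=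
  if (powR_floor s j < powR_floor s (j + 1))%N then e else 0.

Lemma morrey_diff_weak_morrey (R : realType) (V : normedZmodType R)
  (p1 p2 q : R) (e : V) : `|e| = 1 -> 0 < p1 -> p1 < p2 -> p2 <= q ->
  (morrey R V p1 q `\` weak_morrey R V p2 q) !=set0.
Proof.
move=> e1 p10 p12 p2q; have p20 : 0 < p2 by exact: lt_trans p12.
have absE (N : nat) : absz (Num.max 0 (N%:Z + N%:Z + 1)) = N.*2.+1 by lia.
have q0 : 0 < q by exact: lt_le_trans p2q.
pose s := 1 - p1 / q; pose s' := 1 - p2 / q.
have s0 : 0 < s by rewrite subr_gt0 ltr_pdivrMr// mul1r; exact: lt_le_trans p2q.
have s1 : s <= 1 by rewrite gerBl divr_ge0// ltW.
have s'0 : 0 <= s' by rewrite subr_ge0 ler_pdivrMr// mul1r.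
have ss' : 0 < s - s'.
  have : p1 / q < p2 / q by rewrite ltr_pM2r ?invr_gt0.
  by rewrite /s /s'; lra.
pose x := jump_seq R V s e; pose f j : R := (powR_floor s j)%:R.
have xE j : `|x j| = f (j + 1) - f j /\ (`|x j| = 0 \/ `|x j| = 1).
  have /andP[h1 h2] := powR_floor_step s s0 s1 j.
  rewrite /x /jump_seq /f; case: ltnP => h.
    have -> : powR_floor s (j + 1) = (powR_floor s j).+1 by lia.
    by rewrite -natr1 addrC addKr; split=> //; right.
  have -> : powR_floor s (j + 1) = powR_floor s j by lia.
  by rewrite subrr normr0; split=> //; left.
have sum_x m N :
    \sum_(j <- window m N) `|x j| = f (m + N%:Z + 1) - f (m - N%:Z).
  by rewrite -sum_window; apply: eq_bigr => j _; case: (xE j).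
exists x; split.
  (* A window of n elements has fewer than n^s + 1 jumps, and 1 <= n^s. *)
  apply/(morreyP V p10); exists 2 => // m N.
  rewrite (eq_bigr (fun j => `|x j|)); last first.
    by move=> j _; case: (xE j) => _ [->|->]; rewrite ?powR1// powR0// gt_eqF.
  rewrite sum_x -/s.
  have := powR_floor_increment s s0 s1 (m - N%:Z) N.*2.+1.
  rewrite (_ : m - N%:Z + N.*2.+1%:Z = m + N%:Z + 1); last lia.
  rewrite -natr1 -/(f _) -/(f (m - _)) => h.
  have : 1 <= N.*2.+1%:R `^ s :> R.
    rewrite -[leLHS](powRr0 N.*2.+1%:R).
    by apply: ler_powR; rewrite ?ler1n ?(ltW s0).
  by move=> h1; lra.
move=> /(weak_morreyP V p20)[C C0 le_C].
(* The weak bound at level 1/2 will give n^s <= D n^s'; the added 1 absorbs the loss from the floor,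
   as 1 <= n^s'. *)
pose D := C / 2^-1 `^ p2 + 1.
have D0 : 0 < D by rewrite ltr_wpDl// divr_ge0// powR_ge0.
have [N DN] : exists N, D `^ (s - s')^-1 < N.+1%:R.
  by exists (Num.truncn (D `^ (s - s')^-1)); exact: truncnS_gt.
set n : R := N.*2.+1%:R; have n1 : 1 <= n by rewrite ler1n.
have n0 : 0 < n by exact: lt_le_trans n1.
have : n `^ (s - s') <= D.
  rewrite powRB ?(gt_eqF n0) ?implybT// ler_pdivrMr ?powR_gt0//.
  have half0 : 0 < 2^-1 :> R by rewrite invr_gt0.
  (* Centred at N, the window is [0, 2N]; its sum telescopes to f (2N + 1) - f 0, and 2N + 1 is
     exactly n. Level 1/2 separates the values 0 and 1. *)
  have := le_C N%:Z N _ half0; rewrite -/s' -/n.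
  rewrite (eq_bigr (fun j => `|x j|)); last first.
    move=> j _; case: (xE j) => _ [->|->].
      by rewrite ltNge ltW.
    by rewrite invf_lt1 ?ltr1n.
  rewrite sum_x subrr mulrC -ler_pdivlMr ?powR_gt0// mulrAC => h.
  have f0 : f 0 = 0.
    by rewrite /f /powR_floor maxxx /= powR0 ?gt_eqF// truncn0.
  have := powR_floor_gt s (N%:Z + N%:Z + 1).
  rewrite -natr1 -/(f _) absE.
  rewrite -/n => h2.
  have h3 : 1 <= n `^ s' by rewrite -[leLHS](powRr0 n); apply: ler_powR.
  rewrite f0 subr0 in h; rewrite /D mulrDl mul1r; lra.
apply/negP; rewrite -ltNge.
have D1 : D = (D `^ (s - s')^-1) `^ (s - s').
  by rewrite -powRrM mulVf ?gt_eqF// powRr1// ltW.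
rewrite [ltLHS]D1; apply: gt0_ltr_powR; rewrite ?nnegrE ?powR_ge0 ?(ltW n0)//.
by apply: lt_le_trans DN _; rewrite ler_nat ltnS -addnn leq_addr.
Qed.

Theorem theorem2p13 (R : realType) (p1 p2 q : R)
    (hp1 : 1 <= p1) (hp12 : p1 < p2) (hp2q : p2 <= q) :
  (weak_morrey R R p2 q `<=` morrey R R p1 q /\
   (morrey R R p1 q `\` weak_morrey R R p2 q) !=set0) /\
  (weak_morrey R (Rcomplex R) p2 q `<=` morrey R (Rcomplex R) p1 q /\
   (morrey R (Rcomplex R) p1 q `\` weak_morrey R (Rcomplex R) p2 q) !=set0).
Proof.
have p10 : 0 < p1 by exact: lt_le_trans hp1.
split; (split; first exact: weak_morrey_sub_morrey).
- by apply: (morrey_diff_weak_morrey R R p1 p2 q 1) => //; rewrite normr1.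
- apply: (morrey_diff_weak_morrey R (Rcomplex R) p1 p2 q 1) => //.
  exact: ComplexField.Normc.normc1.
Qed.
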